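(* Let $A$ be a Noetherian $\mathbb{Z}^{n}$-graded domain such that $A_{\mathbf 0}$ is a field. Let $\mathbf a,\mathbf b,\mathbf c\in\mathbb{Q}^n\subset\mathbb{R}^n$, and assume that $\mathbf c$ is on the line segment between $\mathbf a$ and $\mathbf b$. Assume $0\neq J_{\mathbf a}(A)\subset J_{\mathbf b}(A)$. Then $J_{\mathbf c}(A)=J_{\mathbf a}(A)$ if $\mathbf c\neq\mathbf b$.
   Context: Rings are commutative with $1$. A $\mathbb{Z}^n$-graded ring is a ring $A=\bigoplus_{\mathbf a\in\mathbb{Z}^n}A_{\mathbf a}$ with additive subgroups $A_{\mathbf a}$ such that $A_{\mathbf a}A_{\mathbf b}\subset A_{\mathbf a+\mathbf b}$; a $\mathbb{Z}^n$-graded domain is one that is an integral domain. For $\mathbf a\in\mathbb{Q}^n$, $I_{\mathbf a}(A)$ is the ideal of $A$ generated by $\bigcup_{\mathbf b\in\mathbb{R}_{>0}\mathbf a\cap\mathbb{Z}^n}A_{\mathbf b}$, and $J_{\mathbf a}(A)=\sqrt{I_{\mathbf a}(A)}$ is the ray ideal of $A$ at $\mathbf a$. *)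

(* Defs.v *)
From mathcomp Require Import all_boot all_order all_algebra.
From mathcomp Require Import boolp classical_sets cardinality fsbigop reals.

Set Implicit Arguments.
Unset Strict Implicit.
Unset Printing Implicit Defensive.

Import Order.TTheory GRing.Theory Num.Theory.
Local Open Scope classical_set_scope.
Local Open Scope ring_scope.

Section Ideals.
Variable A : comNzRingType.

(* Unlike [idealr_closed], the unit ideal is allowed. *)
Definition is_ideal (I : set A) : Prop :=
  [/\ I 0,
      forall x y, I x -> I y -> I (x + y) &
      forall r x, I x -> I (r * x)].

Definition ideal_gen (X : set A) : set A := smallest is_ideal X.

Definition radical (I : set A) : set A := [set x | exists k : nat, I (x ^+ k)].

Definition is_noetherian : Prop :=
  forall I : set A, is_ideal I -> exists s : seq A, I = ideal_gen [set` s].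

(* [divring_closed] would not do: [x^-1] is [x] when [x] is not a unit. *)
Definition is_subfield (S : set A) : Prop :=
  subring_closed (mem S) /\
  forall x, S x -> x != 0 -> exists2 y, S y & x * y = 1.

End Ideals.

Section Graded.
Variables (A : comNzRingType) (n : nat).

Record is_grading (G : 'rV[int]_n -> set A) : Prop := IsGrading {
  grading_subgroup : forall d, zmod_closed (mem (G d));
  grading_mul : forall d e x y, G d x -> G e y -> G (d + e) (x * y);
  (* A is the internal direct sum of the G d; finiteness of the support is
     required because a sum over an infinite support is 0 by convention *)
  grading_direct_sum : forall x : A, exists! f : 'rV[int]_n -> A,
    [/\ forall d, G d (f d),
        finite_set [set d | f d != 0] &
        x = \sum_(d \in [set: 'rV[int]_n]) f d]
}.

Variable R : realType.

Definition real_of_int_row (d : 'rV[int]_n) : 'rV[R]_n := map_mx intr d.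

Definition real_of_rat_row (a : 'rV[rat]_n) : 'rV[R]_n := map_mx ratr a.

Definition ray_points (a : 'rV[rat]_n) : set 'rV[int]_n :=
  [set d | exists2 t : R, 0 < t & real_of_int_row d = t *: real_of_rat_row a].

Definition segment (a b : 'rV[rat]_n) : set 'rV[rat]_n :=
  [set c | exists2 t : R, 0 <= t <= 1 &
    real_of_rat_row c = (1 - t) *: real_of_rat_row a + t *: real_of_rat_row b].

Variable G : 'rV[int]_n -> set A.

Definition pre_ray_ideal (a : 'rV[rat]_n) : set A :=
  ideal_gen (\bigcup_(d in ray_points a) G d).

Definition ray_ideal (a : 'rV[rat]_n) : set A := radical (pre_ray_ideal a).

End Graded.

(* Main.v *)
(* Write I = I_a, and let c = (1 - t) a + t b with 0 < t < 1 (t is rational).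
   If f has degree on the ray of a, then f^k = sum_i g_i y_i with deg g_i on
   the ray of b, and suitable powers satisfy deg (f^p g_i^q) in the ray of c.
   - J_a <= J_c: each f g_i lies in J_c, hence so does f^(k+1).
   - J_c <= J_a: let z have degree d on the ray of c, with deg (f^p g_i^q) = K d.
     In z^K f^p (g_i y_i)^q = (f^p g_i^q) (y_i^q z^K) the first factor on the
     right lies in I and the second has the degree of f^p (f^k)^q, on the ray of
     a.  Summing over i, z^K f^N is in I A_(N deg f).  As I is generated by
     finitely many such f, z^K A_e is contained in I A_e for every e far out on
     the ray of a.  Some such A_e is nonzero and the ideal it generates is
     finitely generated, so the determinant trick in the domain A puts a power
     of z in I. *)
Require Import Defs.
From mathcomp Require Import all_boot all_order all_algebra.
From mathcomp Require Import boolp classical_sets cardinality fsbigop reals.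
From mathcomp Require Import finmap ring.

Set Implicit Arguments.
Unset Strict Implicit.
Unset Printing Implicit Defensive.

Import Order.TTheory GRing.Theory Num.Theory.
Local Open Scope classical_set_scope.
Local Open Scope ring_scope.

(** * Ideals, radicals and finite generation *)

Section IdealTheory.
Variable A : comNzRingType.
Implicit Types (I J X : set A).

Lemma ideal_gen_ideal X : is_ideal (ideal_gen X).
Proof.
split.
- by move=> M [[M0 _ _] _].
- by move=> x y Ix Iy M HM; have [[_ MD _] _] := HM; apply: MD; [apply: Ix | apply: Iy].
- by move=> r x Ix M HM; have [[_ _ MM] _] := HM; apply: MM; apply: Ix.
Qed.

Lemma zero_ideal : is_ideal [set 0 : A].
Proof. by split=> //= [u v -> ->|r u ->]; rewrite ?addr0 ?mulr0. Qed.

Lemma ideal_sum I (T : Type) (r : seq T) (P : pred T) (F : T -> A) :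
  is_ideal I -> (forall i, P i -> I (F i)) -> I (\sum_(i <- r | P i) F i).
Proof. by move=> [I0 ID _] IF; elim/big_ind: _. Qed.

Lemma ideal_mulr I r x : is_ideal I -> I x -> I (x * r).
Proof. by move=> [_ _ IM] Ix; rewrite mulrC; apply: IM. Qed.

Lemma ideal_expr_le I x m k : is_ideal I -> (m <= k)%N -> I (x ^+ m) -> I (x ^+ k).
Proof. by move=> [_ _ IM] mk Ix; rewrite -(subnK mk) exprD; apply: IM. Qed.

Lemma ideal_opp I x : is_ideal I -> I x -> I (- x).
Proof. by move=> [_ _ IM] Ix; rewrite -mulN1r; apply: IM. Qed.

Lemma sub_radical I : I `<=` radical I.
Proof. by move=> x Ix; exists 1%N. Qed.

(* Each term of the binomial expansion has one exponent at least as large as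
   the one demanded of that factor. *)
Lemma binomial_closed (Q : set A) (x y : A) (p q : nat) :
  (forall u v, Q u -> Q v -> Q (u + v)) -> Q 0 ->
  (forall i j, (i + j = p + q)%N -> (p <= i)%N || (q <= j)%N -> Q (x ^+ i * y ^+ j)) ->
  Q ((x + y) ^+ (p + q)).
Proof.
move=> QD Q0 Qxy; rewrite exprDn.
suff Qn u m : Q u -> Q (u *+ m).
  elim/big_ind: _ => // i _; apply: Qn; apply: Qxy; first by rewrite subnK // -ltnS.
  rewrite orbC; case: (leqP q i) => //= iq.
  have iq' : (i <= p + q)%N by rewrite -ltnS.
  by rewrite leq_subRL // addnC leq_add2l ltnW.
by move=> Qu; elim: m => [|m IH]; rewrite ?mulr0n // mulrS; apply: QD.
Qed.

Lemma radical_ideal I : is_ideal I -> is_ideal (radical I).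
Proof.
move=> II; have [I0 ID IM] := II; split.
- by exists 1%N; rewrite expr1.
- move=> x y [p Ix] [q Iy]; exists (p + q)%N; apply: binomial_closed => // i j _.
  case/orP => le; first by apply: ideal_mulr => //; apply: ideal_expr_le Ix.
  by apply: IM; apply: ideal_expr_le Iy.
- by move=> r x [k Ik]; exists k; rewrite exprMn; apply: IM.
Qed.

Lemma radical_expr I x k : radical I (x ^+ k) -> radical I x.
Proof. by move=> [m]; rewrite -exprM => Ix; exists (k * m)%N. Qed.

(** For an ideal [I], this is [I] times the ideal generated by [X]. Only a set is asked of [X], so
    that it can be a graded piece. *)
Definition ideal_prod I X : set A :=
  ideal_gen [set w | exists m x, [/\ I m, X x & w = m * x]].

Lemma ideal_prod_ideal I X : is_ideal (ideal_prod I X).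
Proof. exact: ideal_gen_ideal. Qed.

Lemma mem_ideal_prod I X m x : I m -> X x -> ideal_prod I X (m * x).
Proof. by move=> Im Xx; apply: sub_gen_smallest; exists m, x. Qed.

(** Used with graded pieces: a homogeneous [y] carries I A_d into I A_(d + deg y). *)
Lemma ideal_prod_mulr I X Y w y :
  (forall x, X x -> Y (x * y)) -> ideal_prod I X w -> ideal_prod I Y (w * y).
Proof.
move=> XY; have [J0 JD JM] := ideal_prod_ideal I Y.
apply: (smallest_sub (X := [set w | ideal_prod I Y (w * y)])).
  split; rewrite /= ?mul0r //.
    by move=> u v; rewrite /= mulrDl; apply: JD.
  by move=> r x; rewrite /= -mulrA; apply: JM.
by move=> _ [m [x [Im Xx ->]]] /=; rewrite -mulrA; apply: mem_ideal_prod => //; apply: XY.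
Qed.

Lemma ideal_gen_mono X Y : X `<=` Y -> ideal_gen X `<=` ideal_gen Y.
Proof. by apply: sub_smallest2r; apply: ideal_gen_ideal. Qed.

(** The elements lying in the ideal of some finite part of [X] form an ideal that contains [X]. *)
Lemma ideal_gen_fin X x : ideal_gen X x ->
  exists s : seq A, {in s, forall y, X y} /\ ideal_gen [set` s] x.
Proof.
apply: (smallest_sub (X := [set x | exists s : seq A,
  {in s, forall y, X y} /\ ideal_gen [set` s] x])); last first.
  move=> y Xy; exists [:: y]; split; first by move=> z; rewrite inE => /eqP ->.
  by apply: sub_gen_smallest; rewrite /= inE.
split.
- by exists [::]; split=> //; have [] := ideal_gen_ideal [set` ([::] : seq A)].
- move=> y z [s [sX sy]] [s' [sX' sz]]; exists (s ++ s'); split.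
    by move=> w; rewrite mem_cat => /orP[/sX|/sX'].
  have [_ ID _] := ideal_gen_ideal [set` (s ++ s')]; apply: ID.
    by apply: ideal_gen_mono sy => w /= ws; rewrite mem_cat ws.
  by apply: ideal_gen_mono sz => w /= ws; rewrite mem_cat ws orbT.
- move=> r y [s [sX sy]]; exists s; split=> //.
  by have [_ _ IM] := ideal_gen_ideal [set` s]; apply: IM.
Qed.

(** Generators of [ideal_gen X] need not lie in [X], but each involves only finitely many elements
    of [X]; these are collected in [s]. *)
Lemma noetherian_ideal_gen X : is_noetherian A ->
  exists s : seq A, {in s, forall x, X x} /\ ideal_gen X `<=` ideal_gen [set` s].
Proof.
move=> /(_ _ (ideal_gen_ideal X)) [t Xt].
have: {in t, forall x, ideal_gen X x}.
  by move=> x xt; rewrite Xt; apply: sub_gen_smallest.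
move=> tX; rewrite Xt => {Xt}.
suff [s [sX st]] : exists s : seq A,
    {in s, forall x, X x} /\ {in t, forall x, ideal_gen [set` s] x}.
  by exists s; split=> //; apply: smallest_sub => //; apply: ideal_gen_ideal.
elim: t tX => [|x t IH] tX; first by exists [::].
have [s [sX st]] := IH (fun y yt => tX y (mem_behead (s := x :: t) yt)).
have [s' [sX' sx]] := ideal_gen_fin (tX x (mem_head x t)).
exists (s' ++ s); split=> y; first by rewrite mem_cat => /orP[/sX'|/sX].
rewrite inE => /predU1P[->|/st].
  by apply: ideal_gen_mono sx => w /= ws; rewrite mem_cat ws.
by apply: ideal_gen_mono => w /= ws; rewrite mem_cat ws orbT.
Qed.

End IdealTheory.

(** * The determinant trick *)

Section Determinant.
Variable A : comNzRingType.

(** Congruence modulo [I] respects sums and products, hence the Leibniz expansion. *)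
Lemma det_congr (I : set A) r (M N : 'M[A]_r) : is_ideal I ->
  (forall i j, I (M i j - N i j)) -> I (\det M - \det N).
Proof.
move=> II MN; have [I0 ID IM] := II; rewrite /determinant -sumrB.
apply: ideal_sum => // s _; rewrite -mulrBr; apply: (IM).
elim/big_ind2: _ => [|x' x y' y xx yy|i _]; rewrite ?subrr //.
have -> : x * y - x' * y' = y * (x - x') + x' * (y - y').
  by rewrite !mulrBr [y * x]mulrC [y * x']mulrC addrA subrK.
by apply: ID; apply: IM.
Qed.
End Determinant.

(** The hypothesis on [s] gives a matrix M, congruent to z times the identity modulo [I], that kills
    the vector of the generators. By the adjugate, det M kills [x0], so det M = 0 in the domain,
    while det M is a power of z modulo [I]. *)
Lemma determinant_trick (A : idomainType) (I : set A) (s : seq A) (z x0 : A) :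
  is_ideal I -> x0 \in s -> x0 != 0 ->
  {in s, forall x, ideal_prod I (ideal_gen [set` s]) (z * x)} ->
  exists k, I (z ^+ k).
Proof.
move=> II x0s x0N0 zs; have [I0 ID IM] := II.
set r := size s; pose v : 'cV[A]_r := \col_i s`_i.
(* [comb w]: w is a combination of [s] with coefficients in [I], written as an equation between 1 by
   1 matrices. *)
pose comb (w : A) := exists2 W : 'rV[A]_r, (forall j, I (W 0 j)) & w%:M = W *m v.
have combD w w' : comb w -> comb w' -> comb (w + w').
  move=> [W IW e] [W' IW' e']; exists (W + W').
    by move=> j; rewrite mxE; apply: ID.
  by rewrite mulmxDl -e -e' raddfD.
have comb0 : comb 0 by exists 0; [move=> j; rewrite mxE | rewrite mul0mx raddf0].
have combM t w : comb w -> comb (t * w).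
  move=> [W IW e]; exists (t *: W); first by move=> j; rewrite mxE; apply: IM.
  by rewrite -scalemxAl -e scale_scalar_mx.
have combI m x : I m -> ideal_gen [set` s] x -> comb (m * x).
  move=> Im; apply: (smallest_sub (X := [set x | comb (m * x)])).
    split=> /= [|y y' cy cy'|t y cy]; first by rewrite mulr0.
      by rewrite mulrDr; apply: combD.
    by rewrite mulrCA; apply: combM.
  move=> y ys /=; have ltys : (index y s < r)%N by rewrite index_mem.
  exists (m *: delta_mx 0 (Ordinal ltys)).
    by move=> j; rewrite !mxE; apply: ideal_mulr.
  apply/rowP => i; rewrite ord1 -scalemxAl -rowE !mxE eqxx mulr1n nth_index //.
have combs x : x \in s -> comb (z * x).
  move=> /zs; apply: smallest_sub; first by split.
  by move=> _ [m [y [Im sy ->]]]; apply: combI.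
have /boolp.choice[W HW] : forall i : 'I_r, exists W : 'rV[A]_r,
    (forall j, I (W 0 j)) /\ (z * s`_i)%:M = W *m v.
  by move=> i; have [|W IW e] := combs s`_i; [exact: mem_nth | exists W].
pose M := z%:M - \matrix_i W i.
have Mv : M *m v = 0.
  rewrite mulmxBl mul_scalar_mx; apply/eqP; rewrite subr_eq0; apply/eqP.
  apply/row_matrixP => i; rewrite row_mul rowK -(HW i).2.
  by apply/rowP => j; rewrite ord1 !mxE eqxx mulr1n.
have det0 : \det M = 0.
  have : \adj M *m (M *m v) = 0 by rewrite Mv mulmx0.
  have ltx : (index x0 s < r)%N by rewrite index_mem.
  rewrite mulmxA mul_adj_mx mul_scalar_mx => /matrixP/(_ (Ordinal ltx) 0).
  rewrite !mxE nth_index // => /eqP; rewrite mulf_eq0 (negPf x0N0) orbF.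
  by move/eqP.
exists r; have : I (\det M - \det (z%:M : 'M_r)).
  apply: det_congr => // i j; rewrite !mxE [_ - W _ _ _]addrC addrK.
  by apply: ideal_opp => //; apply: (HW i).1.
rewrite det0 sub0r det_scalar => /(ideal_opp II); by rewrite opprK.
Qed.

(** * Homogeneous components in a graded domain *)

Section Graded.
Variables (A : idomainType) (n : nat) (G : 'rV[int]_n -> set A).
Hypothesis gradG : is_grading G.
Implicit Types d e : 'rV[int]_n.

Lemma grading0 d : G d 0.
Proof. by have [/set_mem] := grading_subgroup gradG d. Qed.

Lemma grading_add d x y : G d x -> G d y -> G d (x + y).
Proof.
have GB u v : G d u -> G d v -> G d (u - v).
  by have [_ GB] := grading_subgroup gradG d => /mem_set ? /mem_set ?; apply/set_mem/GB.
move=> Gx Gy; rewrite -[y]opprK; apply: (GB) => //.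
by rewrite -sub0r; apply: GB => //; apply: grading0.
Qed.

(** [p e] takes the component of degree [e]. The last three properties come from uniqueness: it
    suffices to exhibit a decomposition of the element concerned. *)
Lemma homogeneous_projection : exists p : 'rV[int]_n -> A -> A,
  [/\ forall e x, G e (p e x),
      forall e x y, p e (x + y) = p e x + p e y,
      forall d e x g, G d g -> p e (x * g) = p (e - d) x * g &
      forall e x, G e x -> p e x = x].
Proof.
pose dec x f := [/\ forall d, G d (f d), finite_set [set d | f d != 0] &
        x = \sum_(d \in [set: 'rV[int]_n]) f d].
have decU x f g : dec x f -> dec x g -> f = g.
  have [h [_ hU]] := grading_direct_sum gradG x.
  by move=> /hU <- /hU.
have /boolp.choice[p decp] : forall x, exists f, dec x f.
  by move=> x; have [f []] := grading_direct_sum gradG x; exists f.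
exists (fun e x => p x e); split.
- by move=> e x; have [] := decp x.
- move=> e x y; have [Gx fx Ex] := decp x; have [Gy fy Ey] := decp y.
  suff /(decU _ _ _ (decp (x + y))) -> : dec (x + y) (fun e => p x e + p y e) by [].
  have fU : finite_set ([set d | p x d != 0] `|` [set d | p y d != 0]).
    by rewrite finite_setU.
  split; first by move=> d; apply: grading_add.
    apply: sub_finite_set fU => d /=.
    by apply: contra_neqP => /not_orP[/negP/negPn/eqP-> /negP/negPn/eqP->]; rewrite addr0.
  have out d : d \notin fset_set ([set d | p x d != 0] `|` [set d | p y d != 0]) ->
      p x d = 0 /\ p y d = 0.
    rewrite in_fset_set // => /negP; rewrite in_setE => /not_orP[].
    by move=> /negP/negPn/eqP-> /negP/negPn/eqP->.
  rewrite {1}Ex {1}Ey; set S := fset_set _ in out.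
  rewrite (fsbigTE S); last by move=> d /out[].
  rewrite (fsbigTE S); last by move=> d /out[].
  rewrite (fsbigTE S); last by move=> d /out[-> ->]; rewrite addr0.
  by rewrite big_split.
- move=> d e x g Gg; have [Gx fx Ex] := decp x.
  suff /(decU _ _ _ (decp (x * g))) -> : dec (x * g) (fun e => p x (e - d) * g) by [].
  split.
  + by move=> e'; rewrite -{1}[e'](subrK d); apply: grading_mul.
  + have := finite_image (fun e' => e' + d) fx; apply: sub_finite_set => e' /= H.
    exists (e' - d); last by rewrite subrK.
    by apply: contra_neq H => ->; rewrite mul0r.
  + rewrite {1}Ex mulr_fsuml (reindex_fsbigT (fun e' => e' - d)) //.
    by exists (fun e' => e' + d) => e'; rewrite ?subrK ?addrK.
- move=> e x Gx.
  suff decx : dec x (fun e' => if e' == e then x else 0).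
    by rewrite (decU _ _ _ (decp x) decx) eqxx.
  split.
  + by move=> d; case: (d =P e) => [->|_] //; apply: grading0.
  + by apply: sub_finite_set (finite_set1 e) => d /=; case: (d =P e) => // _; rewrite eqxx.
  + rewrite (fsbigTE [fset e]%fset) ?big_seq_fset1 ?eqxx // => i.
    by rewrite inE => /negPf ->.
Qed.

(** Taking components of degree [e] in a sum of terms r g, with g of degree d, replaces each r by
    its component of degree e - d. *)
Lemma homogeneous_ideal_ind (X : 'rV[int]_n -> set A) (e : 'rV[int]_n) (Q : set A) :
  (forall d, X d `<=` G d) ->
  Q 0 -> (forall x y, Q x -> Q y -> Q (x + y)) ->
  (forall d g y, X d g -> G (e - d) y -> Q (y * g)) ->
  forall x, G e x -> ideal_gen (\bigcup_d X d) x -> Q x.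
Proof.
move=> XG Q0 QD QX x Gx; have [p [pG pD pM p1]] := homogeneous_projection.
(* The multiplier [r] makes the set on the right closed under multiplication by arbitrary ring
   elements. *)
suff H : ideal_gen (\bigcup_d X d) `<=` [set x | forall r, Q (p e (r * x))].
  by move=> /H /(_ 1); rewrite mul1r p1.
apply: smallest_sub.
  split=> /=.
  - by move=> r; rewrite mulr0 p1 //; apply: grading0.
  - by move=> u v Qu Qv r; rewrite mulrDr pD; apply: QD.
  - by move=> r u Qu r'; rewrite mulrA.
by move=> g [d _ Xg] r /=; rewrite (pM _ _ _ _ (XG _ _ Xg)); apply: (QX _ _ _ Xg); apply: pG.
Qed.
End Graded.

(** * Long words over a finite alphabet *)

Section Words.
Variable T : eqType.
Implicit Types s w : seq T.

Lemma leq_uniform_bound s (P : T -> nat -> Prop) :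
  (forall x k k', (k <= k')%N -> P x k -> P x k') ->
  {in s, forall x, exists k, P x k} -> exists k, {in s, forall x, P x k}.
Proof.
move=> Pmono; elim: s => [|x s IH] sP; first by exists 0%N.
have [k Pk] := IH (fun y ys => sP y (mem_behead (s := x :: s) ys)).
have [k' Pk'] := sP x (mem_head x s).
exists (maxn k k') => y; rewrite inE => /predU1P[->|/Pk].
  by apply: Pmono Pk'; apply: leq_maxr.
by apply: Pmono; apply: leq_maxl.
Qed.

Lemma perm_nseq_cat w x k : (k <= count_mem x w)%N ->
  exists w', perm_eq w (nseq k x ++ w').
Proof.
elim: k w => [|k IH] w kw; first by exists w; rewrite perm_refl.
have xw : x \in w by rewrite -has_pred1 has_count (leq_trans _ kw).
have /permPl pw := perm_to_rem xw.
have /IH[w' pw'] : (k <= count_mem x (rem x w))%N.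
  by have /permP/(_ (pred1 x)) := perm_to_rem xw; rewrite /= eqxx => E; rewrite E ltnS in kw.
by exists w'; rewrite pw /= perm_cons.
Qed.

(** If the first letter of [s] occurs fewer than [k] times, deleting it leaves a word over the other
    letters that is still long enough for induction. *)
Lemma word_pigeonhole s w k : {subset w <= s} -> (size s * k < size w)%N ->
  exists x w', x \in s /\ perm_eq w (nseq k x ++ w').
Proof.
elim: s w => [|x s IH] w ws.
  by case: w ws => // y w /(_ y (mem_head y w)).
move=> kw; case: (leqP k (count_mem x w)) => [/perm_nseq_cat[w' pw]|ltk].
  by exists x, w'; rewrite mem_head.
have [||y [w' [ys pw]]] := IH [seq y <- w | predC1 x y].
- by move=> y; rewrite mem_filter /= => /andP[ynx /ws]; rewrite inE (negPf ynx).
- rewrite size_filter -(ltn_add2l (count_mem x w)) count_predC.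
  by apply: leq_trans kw; rewrite /= mulSn ltnS leq_add2r ltnW.
exists y, (w' ++ [seq y <- w | pred1 x y]); rewrite inE ys orbT; split=> //.
apply: (@perm_trans _ ([seq y <- w | pred1 x y] ++ [seq y <- w | predC (pred1 x) y])).
  by rewrite perm_sym (permPl (permEl (perm_filterC _ _))).
by rewrite catA perm_sym perm_catC perm_cat2l perm_sym.
Qed.
End Words.

(** * Rational rays and segments *)

Section Rays.
Variable n : nat.
Implicit Types (a b c : 'rV[rat]_n) (d e : 'rV[int]_n) (R : realType).

Definition rat_of_int_row d : 'rV[rat]_n := map_mx intr d.

Lemma rat_of_int_row_inj : injective rat_of_int_row.
Proof.
move=> d e /matrixP de; apply/matrixP=> i j.
by move: (de i j); rewrite !mxE => /intr_inj.
Qed.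

Lemma rat_of_int_rowD d e : rat_of_int_row (d + e) = rat_of_int_row d + rat_of_int_row e.
Proof. exact: map_mxD. Qed.

Lemma rat_of_int_rowB d e : rat_of_int_row (d - e) = rat_of_int_row d - rat_of_int_row e.
Proof. exact: map_mxB. Qed.

Lemma rat_of_int_rowMn d k : rat_of_int_row (d *+ k) = k%:R *: rat_of_int_row d.
Proof. by rewrite /rat_of_int_row raddfMn scaler_nat. Qed.

(** A nonzero coordinate of [a] expresses the real scalar as a quotient of rationals; if [a] is 0
    then so is [d], and the scalar 1 serves. *)
Lemma ray_pointsP R a d :
  ray_points R a d <-> exists2 t : rat, 0 < t & rat_of_int_row d = t *: a.
Proof.
split=> [[t t0 /matrixP da]|[t t0 /matrixP da]]; last first.
  exists (ratr t); first by rewrite ltr0q.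
  apply/matrixP => i j; have := congr1 (@ratr R) (da i j).
  by rewrite !mxE ratr_int rmorphM.
have [a0|[j aj]] : a = 0 \/ exists j, a 0 j != 0.
  by have [->|/rV0Pn] := eqVneq a 0; [left | right].
  exists 1 => //; apply/matrixP => i j; apply: (@fmorph_inj _ _ (@ratr R)).
  rewrite !mxE /= ratr_int.
  by have := da i j; rewrite a0 !mxE rmorph0 mulr0 => ->.
have Et : t = ratr ((d 0 j)%:~R / a 0 j).
  have := da 0 j; rewrite !mxE => E.
  by rewrite fmorph_div /= ratr_int E mulfK // fmorph_eq0.
exists ((d 0 j)%:~R / a 0 j); first by rewrite -(ltr0q R) -Et.
apply/matrixP => i k; apply: (@fmorph_inj _ _ (@ratr R)).
by have := da i k; rewrite !mxE /= ratr_int rmorphM /= -Et.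
Qed.

(** A coordinate in which [a] and [b] differ expresses the real parameter as a quotient of
    rationals. *)
Lemma segmentP R a b c : segment R a b c -> a != b ->
  exists2 t : rat, 0 <= t <= 1 & c = (1 - t) *: a + t *: b.
Proof.
move=> [t t01 /matrixP cab] ab.
have [j abj] : exists j, (b - a) 0 j != 0 by apply/rV0Pn; rewrite subr_eq0 eq_sym.
have baj : b 0 j - a 0 j != 0 by move: abj; rewrite !mxE.
have Et : t = ratr ((c 0 j - a 0 j) / (b 0 j - a 0 j)).
  have := cab 0 j; rewrite !mxE => E.
  rewrite fmorph_div !rmorphB /= E; apply/esym/(canLR (mulfK _)); last by ring.
  by rewrite -rmorphB fmorph_eq0.
move: Et; move: (_ / _) => r Et; exists r.
  by rewrite -(ler_rat R 0) -(ler_rat R _ 1) rmorph0 rmorph1 -Et.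
apply/matrixP => i k; apply: (@fmorph_inj _ _ (@ratr R)).
by have := cab i k; rewrite !mxE rmorphD !rmorphM rmorphB rmorph1 /= -Et.
Qed.

Lemma rat_commensurable (x y : rat) : 0 < x -> 0 < y ->
  exists p q : nat, [/\ (0 < p)%N, (0 < q)%N & p%:R * x = q%:R * y].
Proof.
move=> x0 y0; have r0 : 0 < x / y by rewrite divr_gt0.
exists `|denq (x / y)|%N, `|numq (x / y)|%N; split.
- by rewrite absz_gt0 denq_neq0.
- by rewrite absz_gt0 numq_eq0 gt_eqF.
- rewrite !natr_absz (gtr0_norm (denq_gt0 _)) gtr0_norm ?numq_gt0 //.
  by rewrite numqE; field; rewrite gt_eqF.
Qed.

Lemma ray_commensurable R c d e : ray_points R c d -> ray_points R c e ->
  exists p q : nat, [/\ (0 < p)%N, (0 < q)%N & d *+ p = e *+ q].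
Proof.
move=> /ray_pointsP[x x0 dx] /ray_pointsP[y y0 ey].
have [p [q [p0 q0 E]]] := rat_commensurable x0 y0.
exists p, q; split=> //; apply: rat_of_int_row_inj.
by rewrite !rat_of_int_rowMn dx ey !scalerA E.
Qed.

(** With d = x a and e = y b, it suffices that p x : q y = (1 - t) : t, which is solvable because x
    t and y (1 - t) are positive rationals. *)
Lemma ray_segment R a b (t : rat) d e : 0 < t < 1 ->
  ray_points R a d -> ray_points R b e ->
  exists p q : nat, [/\ (0 < p)%N, (0 < q)%N &
    ray_points R ((1 - t) *: a + t *: b) (d *+ p + e *+ q)].
Proof.
move=> /andP[t0 t1] /ray_pointsP[x x0 dx] /ray_pointsP[y y0 ey].
have t1' : 0 < 1 - t by rewrite subr_gt0.
have [p [q [p0 q0 E]]] := rat_commensurable (mulr_gt0 x0 t0) (mulr_gt0 y0 t1').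
exists p, q; split=> //; apply/ray_pointsP; exists (p%:R * x / (1 - t)).
  by rewrite divr_gt0 ?mulr_gt0 ?ltr0n.
rewrite rat_of_int_rowD !rat_of_int_rowMn dx ey scalerDr !scalerA divfK ?gt_eqF //.
congr (_ + _ *: _); apply: (mulIf (lt0r_neq0 t1')).
by rewrite -[LHS]mulrA -E; field; rewrite lt0r_neq0.
Qed.

Lemma ray_pointsMn R a d k : (0 < k)%N -> ray_points R a d -> ray_points R a (d *+ k).
Proof.
move=> k0 /ray_pointsP[x x0 dx]; apply/ray_pointsP; exists (k%:R * x).
  by rewrite mulr_gt0 ?ltr0n.
by rewrite rat_of_int_rowMn dx scalerA.
Qed.
End Rays.

(** * Homogeneous elements and ray ideals *)

Section RayIdeals.
Variables (R : realType) (A : idomainType) (n : nat) (G : 'rV[int]_n -> set A).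
Hypotheses (gradG : is_grading G) (G1 : G 0 1).
Implicit Types (a b c : 'rV[rat]_n) (d e : 'rV[int]_n) (f g x y z : A).

Local Notation I := (pre_ray_ideal R G).
Local Notation J := (ray_ideal R G).

Lemma grading_exp d x k : G d x -> G (d *+ k) (x ^+ k).
Proof.
move=> Gx; elim: k => [|k IH]; first by rewrite mulr0n expr0.
by rewrite mulrS exprS; apply: grading_mul.
Qed.

Lemma grading_prod (s : seq A) (deg : A -> 'rV[int]_n) :
  {in s, forall x, G (deg x) x} -> G (\sum_(x <- s) deg x) (\prod_(x <- s) x).
Proof.
elim: s => [|x s IH] sG; first by rewrite !big_nil.
rewrite !big_cons; apply: grading_mul => //; first by apply: sG; apply: mem_head.
by apply: IH => y ys; apply: sG; rewrite inE ys orbT.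
Qed.

(** A homogeneous element of I_a is a sum of products y g of homogeneous elements with deg g on the
    ray of [a]. *)
Lemma ray_ideal_ind a e (Q : set A) : Q 0 -> (forall x y, Q x -> Q y -> Q (x + y)) ->
  (forall d g y, ray_points R a d -> G d g -> G (e - d) y -> Q (y * g)) ->
  forall x, G e x -> I a x -> Q x.
Proof.
move=> Q0 QD Qray x Gx Ix.
pose X d := [set g | ray_points R a d /\ G d g].
apply: (homogeneous_ideal_ind gradG (X := X)) Gx _ => //.
- by move=> d g [].
- by move=> d g y [ad Gg]; apply: Qray.
- by apply: ideal_gen_mono Ix => g [d ad Gg]; exists d.
Qed.

Lemma pre_ray_ideal_ideal a : is_ideal (I a).
Proof. exact: ideal_gen_ideal. Qed.

Lemma ray_ideal_ideal a : is_ideal (J a).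
Proof. exact: radical_ideal (ideal_gen_ideal _). Qed.

Lemma mem_pre_ray_ideal a d f : ray_points R a d -> G d f -> I a f.
Proof. by move=> ad Gf; apply: sub_gen_smallest; exists d. Qed.

Lemma mem_ray_ideal a d f : ray_points R a d -> G d f -> J a f.
Proof. by move=> ad Gf; exact: sub_radical (mem_pre_ray_ideal ad Gf). Qed.

(** [radical K] is an ideal and contains every element that has a power in it, so only the
    homogeneous generators matter. *)
Lemma sub_ray_ideal a (K : set A) : is_ideal K ->
  (forall d f, ray_points R a d -> G d f -> radical K f) -> J a `<=` radical K.
Proof.
move=> IK aK x [k Ik]; apply: (@radical_expr _ _ _ k).
apply: smallest_sub Ik; first exact: radical_ideal.
by move=> f [d ad Gf]; apply: aK Gf.
Qed.

(** * Comparison of the ray ideals at [a] and at (1 - t) a + t b for 0 < t < 1 *)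

Section Segment.
Variables (a b : 'rV[rat]_n) (t : rat).
Hypotheses (t01 : 0 < t < 1) (Jab : J a `<=` J b).
Local Notation c := ((1 - t) *: a + t *: b).

Lemma ray_ideal_sub_segment : J a `<=` J c.
Proof.
have JI := ray_ideal_ideal c; have [J0 JD JM] := JI.
apply: sub_ray_ideal; first exact: ideal_gen_ideal.
move=> d f ad Gf; have [k Ifk] := Jab (mem_ray_ideal ad Gf).
apply: (@radical_expr _ _ _ k.+1); rewrite exprS.
apply: (ray_ideal_ind (Q := [set x | J c (f * x)])) (grading_exp k Gf) Ifk.
- by rewrite /= mulr0.
- by move=> x y /= Jx Jy; rewrite mulrDr; apply: JD.
move=> e g y be Gg _ /=; rewrite mulrCA; apply: JM.
have [p [q [p0 q0 cpq]]] := ray_segment t01 ad be.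
(* The exponent p + q leaves room in (f g)^(p + q) for the factor f^p g^q, whose degree lies on the
   ray of [c]. *)
exists (p + q)%N; rewrite exprMn !exprD.
have -> : f ^+ p * f ^+ q * (g ^+ p * g ^+ q) = f ^+ p * g ^+ q * (f ^+ q * g ^+ p).
  by ring.
apply: (ideal_mulr _ (ideal_gen_ideal _)); apply: (mem_pre_ray_ideal cpq).
by apply: grading_mul => //; apply: grading_exp.
Qed.

(** Serves to make exponents equal: z^(m - k) is absorbed by the ideal, and f^(m - l) shifts the
    degree. *)
Lemma ideal_prod_exp_mono (K : set A) d z f k l m : G d f ->
  (k <= m)%N -> (l <= m)%N ->
  ideal_prod K (G (d *+ l)) (z ^+ k * f ^+ l) ->
  ideal_prod K (G (d *+ m)) (z ^+ m * f ^+ m).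
Proof.
move=> Gf km lm H.
have -> : z ^+ m * f ^+ m = z ^+ (m - k) * (z ^+ k * f ^+ l * f ^+ (m - l)).
  by rewrite -!mulrA -exprD subnKC // mulrA -exprD subnK.
have [_ _] := ideal_prod_ideal K (G (d *+ m)).
apply; apply: ideal_prod_mulr H => x Gx.
have -> : d *+ m = d *+ l + d *+ (m - l) by rewrite -mulrnDr subnKC.
by apply: grading_mul => //; apply: grading_exp.
Qed.

Lemma ray_generator_power d z e f : ray_points R c d -> G d z ->
  ray_points R a e -> G e f ->
  exists k, ideal_prod (I a) (G (e *+ k)) (z ^+ k * f ^+ k).
Proof.
move=> cd Gz ae Gf; have [k Ifk] := Jab (mem_ray_ideal ae Gf).
have [I0 ID IM] := pre_ray_ideal_ideal a.
(* The exponents vary with the summand of f^k, so they are kept separate; e (P + k M) is the degree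
   of f^P (f^k)^M. *)
suff [K [P [M H]]] : exists K P M,
    ideal_prod (I a) (G (e *+ (P + k * M))) (z ^+ K * f ^+ P * (f ^+ k) ^+ M).
  exists (maxn K (P + k * M)); rewrite -exprM -mulrA -exprD in H.
  by apply: ideal_prod_exp_mono H; rewrite ?leq_maxl ?leq_maxr.
pose Q := [set x | G (e *+ k) x /\ exists K P M,
    ideal_prod (I a) (G (e *+ (P + k * M))) (z ^+ K * f ^+ P * x ^+ M)].
suff [] : Q (f ^+ k) by [].
apply: (ray_ideal_ind (Q := Q)) (grading_exp k Gf) Ifk.
- split; first exact: (grading0 gradG).
  (* M is 1 because 0^0 = 1. *)
  exists 0%N, 0%N, 1%N; rewrite expr1 mulr0.
  by have [] := ideal_prod_ideal (I a) (G (e *+ (0 + k * 1))).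
- move=> x y [Gx [K [P [M Hx]]]] [Gy [K' [P' [M' Hy]]]]; split; first exact: (grading_add gradG).
  exists (K + K')%N, (P + P')%N, (M + M')%N.
  have [E0 ED EM] := ideal_prod_ideal (I a) (G (e *+ (P + P' + k * (M + M')))).
  apply: (binomial_closed (Q := [set w | ideal_prod (I a)
    (G (e *+ (P + P' + k * (M + M')))) (z ^+ (K + K') * f ^+ (P + P') * w)])).
  + by move=> u v /= Hu Hv; rewrite mulrDr; apply: ED.
  + by rewrite /= mulr0.
  move=> i j ij /orP[Mi|M'j] /=.
    have -> : z ^+ (K + K') * f ^+ (P + P') * (x ^+ i * y ^+ j) =
       z ^+ K' * ((z ^+ K * f ^+ P * x ^+ M) * (f ^+ P' * (x ^+ (i - M) * y ^+ j))).
      by rewrite !exprD -{1}(subnK Mi) exprD; ring.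
    apply: EM; apply: ideal_prod_mulr Hx => u Gu.
    have -> : e *+ (P + P' + k * (M + M')) =
       e *+ (P + k * M) + (e *+ P' + (e *+ k *+ (i - M) + e *+ k *+ j)).
      by rewrite -!mulrnA -!mulrnDr; congr (_ *+ _); rewrite -ij -{1}(subnKC Mi); ring.
    by do ?[apply: grading_mul => //]; apply: grading_exp.
  have -> : z ^+ (K + K') * f ^+ (P + P') * (x ^+ i * y ^+ j) =
     z ^+ K * ((z ^+ K' * f ^+ P' * y ^+ M') * (f ^+ P * (x ^+ i * y ^+ (j - M')))).
    by rewrite !exprD -{1}(subnK M'j) exprD; ring.
  apply: EM; apply: ideal_prod_mulr Hy => u Gu.
  have -> : e *+ (P + P' + k * (M + M')) =
     e *+ (P' + k * M') + (e *+ P + (e *+ k *+ i + e *+ k *+ (j - M'))).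
    by rewrite -!mulrnA -!mulrnDr; congr (_ *+ _); rewrite -ij -{1}(subnKC M'j); ring.
  by do ?[apply: grading_mul => //]; apply: grading_exp.
- move=> e' g y be Gg Gy; split.
    by rewrite -[e *+ k](subrK e'); apply: grading_mul.
  (* The exponents are chosen so that f^(p m) g^(q m) and z^l have the same degree. *)
  have [p [q [p0 q0 cpq]]] := ray_segment t01 ae be.
  have [m [l [m0 l0 E]]] := ray_commensurable cpq cd.
  exists l, (p * m)%N, (q * m)%N.
  have -> : z ^+ l * f ^+ (p * m) * (y * g) ^+ (q * m) =
      f ^+ (p * m) * g ^+ (q * m) * (y ^+ (q * m) * z ^+ l).
    by rewrite exprMn; ring.
  (* The factor f^(p m) g^(q m) lies in I_a since p m > 0; the cofactor y^(q m) z^l has the degree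
     of f^(p m) (f^k)^(q m). *)
  apply: mem_ideal_prod.
    apply: (ideal_mulr _ (pre_ray_ideal_ideal a)).
    apply: (mem_pre_ray_ideal (ray_pointsMn _ ae) (grading_exp _ Gf)).
    by rewrite muln_gt0 p0.
  have -> : e *+ (p * m + k * (q * m)) = (e *+ k - e') *+ (q * m) + d *+ l.
    rewrite -E mulrnBl mulrnDl -!mulrnA addrACA.
    by rewrite addNr addr0 -mulrnDr addnC.
  by apply: grading_mul => //; apply: grading_exp.
Qed.

(** One exponent k serves all of finitely many homogeneous generators of I_a. Far out on the ray,
    every element is a sum of multiples of monomials in them that are long enough to contain some
    f^k. *)
Lemma ray_ideal_absorb d z : is_noetherian A -> ray_points R c d -> G d z ->
  exists (k : nat) (u0 : rat), forall e (u : rat) x,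
    rat_of_int_row e = u *: a -> u0 < u -> G e x ->
    ideal_prod (I a) (G e) (z ^+ k * x).
Proof.
move=> noethA cd Gz.
have [s [sa Is]] := noetherian_ideal_gen (\bigcup_(d in ray_points R a) G d) noethA.
(* [k] also bounds the scalar of deg f, so that splitting off one generator lowers the scalar of the
   cofactor by at most [k]. *)
pose P f k := exists e, [/\ exists2 u : rat, 0 < u <= k%:R & rat_of_int_row e = u *: a,
  G e f & ideal_prod (I a) (G (e *+ k)) (z ^+ k * f ^+ k)].
have [k Pk] : exists k, {in s, forall f, P f k}.
  apply: leq_uniform_bound.
    move=> f k k' kk' [e [[u /andP[u0 uk] eu] Gf H]]; exists e; split=> //.
      by exists u => //; rewrite u0 (le_trans uk) ?ler_nat.
    exact: ideal_prod_exp_mono H.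
  move=> f /sa[e ae Gf]; have [k Hk] := ray_generator_power cd Gz ae Gf.
  have /ray_pointsP[u u0 eu] := ae.
  have [m um] : exists m : nat, u <= m%:R.
    by exists (Num.truncn u).+1; rewrite ltW // truncnS_gt.
  exists (maxn k m), e; split=> //.
    by exists u => //; rewrite u0 (le_trans um) // ler_nat leq_maxr.
  by apply: ideal_prod_exp_mono Hk; rewrite ?leq_maxl.
have /boolp.choice[deg Hdeg] : forall f, exists e, f \in s ->
    [/\ exists2 u : rat, 0 < u <= k%:R & rat_of_int_row e = u *: a,
    G e f & ideal_prod (I a) (G (e *+ k)) (z ^+ k * f ^+ k)].
  move=> f; case: (boolP (f \in s)) => [/Pk[e He]|_]; last by exists 0.
  by exists e.
have Gdeg (w : seq A) : {subset w <= s} -> {in w, forall x, G (deg x) x}.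
  by move=> ws x /ws /Hdeg[].
(* Expanding [y] along the generators lengthens the word [w]; once [w] is long
   enough, some generator occurs in it at least [k] times. *)
have word M w y e u : (size s * k < size w + M)%N -> {subset w <= s} -> G e y ->
    rat_of_int_row e = u *: a -> M%:R * k%:R < u ->
    ideal_prod (I a) (G (\sum_(x <- w) deg x + e)) (z ^+ k * (\prod_(x <- w) x * y)).
  elim: M w y e u => [|M IH] w y e u size_w ws Gy eu ltu.
    rewrite addn0 in size_w.
    have [f [w' [fs pw]]] := word_pigeonhole ws size_w.
    have [_ Gf Hf] := Hdeg f fs.
    rewrite !(perm_big _ pw) /= !big_cat /= !big_nseq.
    rewrite -addrA !iter_addr_0 iter_mulr_1 -[_ * _ * y]mulrA [z ^+ k * _]mulrA.
    apply: ideal_prod_mulr Hf => x Gx.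
    apply: grading_mul => //; apply: grading_mul => //.
    apply: grading_prod; apply: Gdeg => x' x'w; apply: ws.
    by rewrite (perm_mem pw) mem_cat x'w orbT.
  (* [M] counts the expansions still to come; the bound on [u] keeps deg y on the ray of [a], so y
     can be expanded. *)
  have Iay : I a y.
    apply: mem_pre_ray_ideal Gy; apply/ray_pointsP; exists u => //.
    by apply: le_lt_trans ltu; rewrite mulr_ge0 ?ler0n.
  have [E0 ED EM] := ideal_prod_ideal (I a) (G (\sum_(x <- w) deg x + e)).
  pose X e' := [set g | [/\ g \in s, e' = deg g & G e' g]].
  apply: (homogeneous_ideal_ind gradG (X := X) (e := e) (Q := [set y |
    ideal_prod (I a) (G (\sum_(x <- w) deg x + e)) (z ^+ k * (\prod_(x <- w) x * y))])) Gy _.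
  - by move=> e' g [].
  - by rewrite /= !mulr0.
  - by move=> y1 y2 /= H1 H2; rewrite !mulrDr; apply: ED.
  - move=> e' g y' [gs -> Gg] Gy' /=.
    have [[v /andP[v0 vk] gv] _ _] := Hdeg g gs.
    have -> : z ^+ k * (\prod_(x <- w) x * (y' * g)) = z ^+ k * (\prod_(x <- g :: w) x * y').
      by rewrite big_cons; ring.
    have -> : \sum_(x <- w) deg x + e = \sum_(x <- g :: w) deg x + (e - deg g).
      by rewrite big_cons [deg g + _]addrC addrACA subrr addr0.
    apply: (IH _ _ _ (u - v)) => //.
    + by rewrite /= addSnnS.
    + by move=> x; rewrite inE => /predU1P[->|/ws].
    + by rewrite rat_of_int_rowB eu gv scalerBl.
    + by rewrite ltrBrDr; apply: le_lt_trans ltu; rewrite -natr1 mulrDl mul1r lerD2l.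
  - apply: ideal_gen_mono (Is _ Iay) => g gs.
    by exists (deg g) => //; split=> //; have [] := Hdeg g gs.
(* Starting from the empty word, size s * k + 1 expansions exceed the pigeonhole bound. *)
exists k, ((size s * k).+1%:R * k%:R) => e u x eu ltu Gx.
have := word (size s * k).+1 [::] x e u.
rewrite !big_nil add0r mul1r; apply=> //.
Qed.

Lemma segment_sub_ray_ideal : is_noetherian A -> J a <> [set 0] -> J c `<=` J a.
Proof.
move=> noethA Ja0; apply: sub_ray_ideal; first exact: ideal_gen_ideal.
move=> d z cd Gz.
(* If all pieces on the ray vanished, I_a would be 0, and so would its radical in a domain. *)
have [e ae [f Gf f0]] : exists2 e, ray_points R a e & exists2 f, G e f & f != 0.
  apply: contrapT => H; apply: Ja0; apply/seteqP; split=> x; last first.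
    by move=> ->; have [] := ray_ideal_ideal a.
  move=> [k Ixk]; have : x ^+ k = 0.
    apply: (smallest_sub (X := [set 0])) Ixk; first exact: zero_ideal.
    move=> g [e ae Gg] /=; apply: contrapT => /eqP g0; apply: H.
    by exists e => //; exists g.
  by move/eqP; rewrite expf_eq0 => /andP[_ /eqP].
have [k [u0 Hk]] := ray_ideal_absorb noethA cd Gz.
have /ray_pointsP[v v0 ev] := ae.
(* [L] pushes the degree of f^L beyond the bound [u0]. *)
pose L := (Num.truncn (u0 / v)).+1.
have Lu : u0 < L%:R * v by rewrite -ltr_pdivrMr // truncnS_gt.
have Le : rat_of_int_row (e *+ L) = (L%:R * v) *: a.
  by rewrite rat_of_int_rowMn ev scalerA.
have [s [sG Hs]] := noetherian_ideal_gen (G (e *+ L)) noethA.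
have fL0 : f ^+ L != 0 by rewrite expf_neq0.
(* The determinant trick needs a nonzero generator; f^L, which is nonzero, lies in the ideal
   generated by [s]. *)
have [x0 x0s x00] : exists2 x0, x0 \in s & x0 != 0.
  apply: contrapT => H; move/eqP: fL0; apply.
  have : ideal_gen [set` s] (f ^+ L).
    by apply: Hs; apply: sub_gen_smallest; apply: grading_exp.
  apply: (smallest_sub (X := [set 0])); first exact: zero_ideal.
  by move=> g gs /=; apply: contrapT => /eqP g0; apply: H; exists g.
have [|m Im] := determinant_trick (z := z ^+ k) (pre_ray_ideal_ideal a) x0s x00.
  move=> x xs; have := Hk _ _ _ Le Lu (sG x xs).
  apply: ideal_gen_mono => _ [m [y [Im Gy ->]]]; exists m, y; split=> //.
  by apply: Hs; apply: sub_gen_smallest.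
by apply: (@radical_expr _ _ _ k); exists m.
Qed.
End Segment.
End RayIdeals.

Theorem theorem3p1 (R : realType) (n : nat) (A : idomainType)
    (G : 'rV[int]_n -> set A) (a b c : 'rV[rat]_n) :
  is_noetherian A ->
  is_grading G ->
  is_subfield (G 0) ->
  segment R a b c ->
  ray_ideal R G a <> [set 0] ->
  ray_ideal R G a `<=` ray_ideal R G b ->
  c <> b ->
  ray_ideal R G c = ray_ideal R G a.
Proof.
move=> noethA gradG [[/set_mem G1 _ _] _] abc Ja0 Jab cb.
(* For a = b the segment is the single point b, which c is assumed to avoid. *)
have [ab|ab] := eqVneq a b.
  case: cb; have [t _] := abc; rewrite -ab -scalerDl subrK scale1r => /matrixP ca.
  apply/matrixP => i j; apply: (@fmorph_inj _ _ (@ratr R)).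
  by have := ca i j; rewrite !mxE.
have [t /andP[t0 t1] ct] := segmentP abc ab.
(* The endpoints: t = 1 would give c = b, and t = 0 gives c = a, where nothing is left to prove. *)
have t1' : t < 1.
  rewrite lt_neqAle t1 andbT; apply/eqP => t1e; apply: cb.
  by rewrite ct t1e subrr scale0r add0r scale1r.
have [t0e|t0e] := eqVneq t 0; first by rewrite ct t0e subr0 scale0r addr0 scale1r.
have t01 : 0 < t < 1 by rewrite lt0r t0e t0 t1'.
rewrite ct; apply/seteqP; split.
  exact: (segment_sub_ray_ideal gradG G1 t01 Jab noethA Ja0).
exact: (ray_ideal_sub_segment gradG G1 t01 Jab).
Qed.
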